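(* Let $n\ge 2$, let $\mathbb F$ be a field, and let $\mathfrak S$ be a line-spread of $\mathrm{PG}(n,\mathbb F)$ which admits a dual. For a point $p$ of $\mathrm{PG}(n,\mathbb F)$ let $\ell_p$ be the member of $\mathfrak S$ containing $p$. Then the set $$\mathcal H_{\mathfrak S}=\{(p,H)\mid (p,H)\text{ a point of }A_{n,\{1,n\}}(\mathbb F),\ \ell_p\subseteq H\}$$ is a geometric hyperplane of $A_{n,\{1,n\}}(\mathbb F)$.
   Context: $A_{n,\{1,n\}}(\mathbb F)$ is the point-line geometry whose points are the pairs $(p,H)$ with $p$ a point and $H$ a hyperplane of $\mathrm{PG}(n,\mathbb F)$ such that $p\in H$; its lines are the sets $\{(p,H)\mid p\in\ell\}$ for $\ell$ a line and $H$ a hyperplane with $\ell\subseteq H$, and the sets $\{(p,H)\mid H\supseteq L\}$ for $L$ a subspace of codimension $2$ and $p\in L$. A subspace is a set $X$ of points such that every line meeting $X$ in at least two points lies in $X$; a geometric hyperplane is a proper subspace meeting every line. A line-spread of $\mathrm{PG}(n,\mathbb F)$ is a set of lines such that every point lies on exactly one of them. A dual line-spread is a set $\mathfrak S^*$ of codimension-$2$ subspaces (sub-hyperplanes) such that every hyperplane contains exactly one member of $\mathfrak S^*$. A line-spread $\mathfrak S$ admits a dual if there is a dual line-spread $\mathfrak S^*$ such that for every $L\in\mathfrak S^*$ the members of $\mathfrak S$ contained in $L$ form a line-spread of the projective space $L$ (for $L$ of dimension $1$, $\{L\}$ is regarded as its unique line-spread). *)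

(* Defs.v *)
From mathcomp Require Import all_boot all_order all_algebra.
From mathcomp Require Import boolp classical_sets.

Set Implicit Arguments.
Unset Strict Implicit.
Unset Printing Implicit Defensive.

Import GRing.Theory.

Local Open Scope classical_set_scope.
Local Open Scope ring_scope.

Record point_line_geometry (T : Type) := PointLineGeometry {
  points : set T;
  lines : set (set T)
}.

Definition geom_subspace (T : Type) (G : point_line_geometry T) (X : set T) :
    Prop :=
  X `<=` points G /\
  forall A, lines G A ->
    (exists x y, [/\ x <> y, (A `&` X) x & (A `&` X) y]) -> A `<=` X.

Definition geom_hyperplane (T : Type) (G : point_line_geometry T) (X : set T) :
    Prop :=
  [/\ geom_subspace G X, X <> points G &
      forall A, lines G A -> exists x, (A `&` X) x].

Section ProjectiveSpace.
Variables (F : fieldType) (n : nat).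

(* Subspaces of PG(n, F) are the vector subspaces of F^(n+1); the projective
   dimension is the vector dimension minus one, and incidence is (_ <= _)%VS. *)
Definition pg_sub := {vspace 'rV[F]_n.+1}.

Definition pg_point (U : pg_sub) : Prop := \dim U = 1%N.
Definition pg_line (U : pg_sub) : Prop := \dim U = 2%N.
Definition pg_codim (k : nat) (U : pg_sub) : Prop := (\dim U + k = n.+1)%N.
Definition pg_hyperplane (U : pg_sub) : Prop := pg_codim 1 U.
Definition pg_subhyperplane (U : pg_sub) : Prop := pg_codim 2 U.

(* A_{n,{1,n}}(F) *)
Definition A1n_points : set (pg_sub * pg_sub) :=
  [set x | [/\ pg_point x.1, pg_hyperplane x.2 & (x.1 <= x.2)%VS]].

Definition A1n_line_pt (l H : pg_sub) : set (pg_sub * pg_sub) :=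
  [set x | [/\ pg_point x.1, (x.1 <= l)%VS & x.2 = H]].

Definition A1n_line_hyp (p L : pg_sub) : set (pg_sub * pg_sub) :=
  [set x | [/\ x.1 = p, pg_hyperplane x.2 & (L <= x.2)%VS]].

Definition A1n_lines : set (set (pg_sub * pg_sub)) :=
  [set A | (exists l H, [/\ pg_line l, pg_hyperplane H, (l <= H)%VS &
                            A = A1n_line_pt l H]) \/
           (exists p L, [/\ pg_point p, pg_subhyperplane L, (p <= L)%VS &
                            A = A1n_line_hyp p L])].

Definition A1n : point_line_geometry (pg_sub * pg_sub) :=
  PointLineGeometry A1n_points A1n_lines.

(* S is a line-spread of the projective space on U.  When U is itself a line,
   this forces S = [set U]. *)
Definition line_spread_in (U : pg_sub) (S : set pg_sub) : Prop :=
  (forall l, S l -> pg_line l /\ (l <= U)%VS) /\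
  (forall p, pg_point p -> (p <= U)%VS -> exists! l, S l /\ (p <= l)%VS).

Definition line_spread (S : set pg_sub) : Prop := line_spread_in fullv S.

Definition dual_line_spread (Sd : set pg_sub) : Prop :=
  (forall L, Sd L -> pg_subhyperplane L) /\
  (forall H, pg_hyperplane H -> exists! L, Sd L /\ (L <= H)%VS).

Definition admits_dual (S : set pg_sub) : Prop :=
  exists2 Sd, dual_line_spread Sd &
    forall L, Sd L -> line_spread_in L [set l | S l /\ (l <= L)%VS].

(* The member of S through p; the default value 0 is never used when S is a
   line-spread and p a point (spread_lineP). *)
Definition spread_line (S : set pg_sub) (p : pg_sub) : pg_sub :=
  xget 0%VS [set l | S l /\ (p <= l)%VS].

Definition spread_hyperplane (S : set pg_sub) : set (pg_sub * pg_sub) :=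
  [set x | A1n_points x /\ (spread_line S x.1 <= x.2)%VS].

Lemma spread_lineP (S : set pg_sub) (p l : pg_sub) :
  line_spread S -> pg_point p -> (S l /\ (p <= l)%VS) <-> l = spread_line S p.
Proof.
move=> [_ Sp] pp; have [m [Sm um]] := Sp p pp (subvf p).
have -> : spread_line S p = m.
  by apply: xget_unique => // y /um.
by split=> [/um|->].
Qed.

Lemma line_spread_in_line (U : pg_sub) (S : set pg_sub) :
  pg_line U -> line_spread_in U S <-> S = [set U].
Proof.
move=> dU; split=> [[SU Sp]|->].
  have eqU l : S l -> l = U.
    case/SU=> dl lU; apply/eqP; rewrite eqEdim lU /=.
    by rewrite [\dim U]dU [\dim l]dl.
  apply/seteqP; split=> [l /eqU //|_ ->].
  have U0 : U != 0%VS by rewrite -dimv_eq0 [\dim U]dU.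
  have dp : pg_point <[vpick U]>%VS by rewrite /pg_point dim_vline vpick0 U0.
  have [|l [[Sl _] _]] := Sp _ dp; first exact: memv_pick.
  by rewrite -(eqU _ Sl).
split=> [l -> //|p _ pU]; exists U; split=> // l [-> //].
Qed.

End ProjectiveSpace.

(* Main.v *)
Require Import Defs.
From mathcomp Require Import all_boot all_order all_algebra.
From mathcomp Require Import boolp classical_sets zify.

Set Implicit Arguments.
Unset Strict Implicit.
Unset Printing Implicit Defensive.

(** For a hyperplane [H] let [L_H] be the member of the dual spread contained
    in [H].  A spread line contained in [H] meets [L_H] for dimension reasons,
    hence is contained in [L_H], because [L_H] is partitioned by spread lines.
    So for a point [p] of [H] the condition [l_p <= H] amounts to [p <= L_H].
    The first form is linear in [H] and settles the lines with [p] fixed; the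
    second is linear in [p] and settles the lines with [H] fixed. *)

Section SubspaceDimension.
Variables (K : fieldType) (vT : vectType K).
Implicit Types U V W : {vspace vT}.

Lemma exists_subv_dim U (m : nat) :
  (m <= \dim U)%N -> exists2 V, (V <= U)%VS & \dim V = m.
Proof.
move=> lemU; exists <<take m (vbasis U)>>%VS.
  by apply/span_subvP=> v /mem_take; apply: vbasis_mem.
have free_take : free (take m (vbasis U)).
  apply: (@catl_free _ _ (drop m (vbasis U))).
  by rewrite cat_take_drop; apply: basis_free (vbasisP U).
by rewrite (eqP free_take) size_takel // size_tuple.
Qed.

Lemma exists_supv_dim U (m : nat) :
  (\dim U <= m <= \dim {:vT})%N -> exists2 V, (U <= V)%VS & \dim V = m.
Proof.
case/andP=> leUm lemT.
have [|V sVUc dV] := @exists_subv_dim (U^C)%VS (m - \dim U).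
  by rewrite dimv_compl leq_sub2r.
exists (U + V)%VS; first exact: addvSl.
have UV0 : (U :&: V)%VS = 0%VS.
  by apply/eqP; rewrite -subv0 -(capv_compl U) capvS.
by rewrite dimv_disjoint_sum // dV subnKC.
Qed.

Lemma exists_dim1_notin U V : ~~ (U <= V)%VS ->
  exists p : {vspace vT}, [/\ \dim p = 1%N, (p <= U)%VS & ~~ (p <= V)%VS].
Proof.
case/subvPn=> v vU vV; exists <[v]>%VS; split=> //.
by rewrite dim_vline; case: eqP vV => // ->; rewrite mem0v.
Qed.

Lemma leq_dimv_cap U V W : (U <= W)%VS -> (V <= W)%VS ->
  (\dim U + \dim V <= \dim W + \dim (U :&: V))%N.
Proof.
by move=> sUW sVW; rewrite -dimv_sum_cap leq_add2r dimvS // subv_add sUW.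
Qed.

Lemma addv_eq_dimS U V W : \dim U = \dim V -> \dim W = (\dim U).+1 ->
  (U <= W)%VS -> (V <= W)%VS -> U <> V -> (U + V)%VS = W.
Proof.
move=> dUV dW sUW sVW neUV; apply/eqP.
rewrite eqEdim subv_add sUW sVW dW ltnNge; apply/negP=> leUV; apply: neUV.
have eqU : U = (U + V)%VS by apply/eqP; rewrite eqEdim addvSl.
by apply/esym/eqP; rewrite eqEdim dUV leqnn andbT eqU addvSr.
Qed.

Lemma capv_eq_dimS U V W : \dim U = \dim V -> \dim U = (\dim W).+1 ->
  (W <= U)%VS -> (W <= V)%VS -> U <> V -> (U :&: V)%VS = W.
Proof.
move=> dUV dU sWU sWV neUV; apply/esym/eqP.
rewrite eqEdim subv_cap sWU sWV leqNgt; apply/negP=> ltW; apply: neUV.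
have eqU : (U :&: V)%VS = U by apply/eqP; rewrite eqEdim capvSl dU.
by apply/eqP; rewrite eqEdim dUV leqnn andbT -eqU capvSr.
Qed.

End SubspaceDimension.

Section PencilsOfFlags.
Variables (F : fieldType) (n : nat).
Implicit Types (p l H L M : pg_sub F n) (x y : pg_sub F n * pg_sub F n).

Lemma exists_pg_hyperplane M :
  (\dim M <= n)%N -> exists2 H, pg_hyperplane H & (M <= H)%VS.
Proof.
move=> leMn; have [|H sMH dH] := @exists_supv_dim _ _ M n.
  by rewrite leMn dimvf dim_matrix [leqRHS]mul1n leqnSn.
by exists H; rewrite // /pg_hyperplane /pg_codim dH addn1.
Qed.

Lemma A1n_line_pt_sub_points l H : pg_hyperplane H -> (l <= H)%VS ->
  (A1n_line_pt l H `<=` @A1n_points F n)%classic.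
Proof.
by move=> dH slH [p M] [/= dp spl ->]; split=> //=; apply: subv_trans slH.
Qed.

Lemma A1n_line_hyp_sub_points p L : pg_point p -> (p <= L)%VS ->
  (A1n_line_hyp p L `<=` @A1n_points F n)%classic.
Proof.
by move=> dp spL [q H] [/= -> dH sLH]; split=> //=; apply: subv_trans sLH.
Qed.

Lemma A1n_line_pt_join l H x y : pg_line l ->
  A1n_line_pt l H x -> A1n_line_pt l H y -> x <> y -> (x.1 + y.1)%VS = l.
Proof.
case: x y => [p M] [q M'] dl [/= dp spl eM] [/= dq sql eM'] neq.
rewrite {}eM {}eM' in neq.
apply: addv_eq_dimS; rewrite ?[\dim p]dp ?[\dim q]dq // => eq_pq.
by rewrite eq_pq in neq.
Qed.

Lemma A1n_line_hyp_meet p L x y : pg_subhyperplane L ->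
  A1n_line_hyp p L x -> A1n_line_hyp p L y -> x <> y -> (x.2 :&: y.2)%VS = L.
Proof.
rewrite /pg_subhyperplane /A1n_line_hyp /pg_hyperplane /pg_codim.
case: x y => [q H] [q' M] dL [/= eq_p dH sLH] [/= eq'_p dM sLM] neq.
rewrite {}eq_p {}eq'_p in neq.
by apply: capv_eq_dimS => // [||eq_HM]; [lia | lia | rewrite eq_HM in neq].
Qed.

Lemma A1n_line_pt_meets_subhyperplane l H M : pg_line l -> pg_hyperplane H ->
  (l <= H)%VS -> pg_subhyperplane M -> (M <= H)%VS ->
  exists2 x, A1n_line_pt l H x & (x.1 <= M)%VS.
Proof.
rewrite /pg_line /pg_hyperplane /pg_subhyperplane /pg_codim.
move=> dl dH slH dM sMH; have dim_cap := leq_dimv_cap slH sMH.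
have [|p + dp] := @exists_subv_dim _ _ (l :&: M)%VS 1; first by lia.
by rewrite subv_cap => /andP[spl spM]; exists (p, H).
Qed.

Lemma A1n_line_hyp_meets_line p L l : pg_point p -> pg_subhyperplane L ->
  (p <= L)%VS -> pg_line l -> (p <= l)%VS ->
  exists2 x, A1n_line_hyp p L x & (l <= x.2)%VS.
Proof.
rewrite /pg_point /pg_subhyperplane /pg_codim /pg_line => dp dL spL dl spl.
have le_cap : (\dim p <= \dim (L :&: l))%N by rewrite dimvS // subv_cap spL.
have [|H dH] := @exists_pg_hyperplane (L + l)%VS.
  by have := dimv_sum_cap L l; lia.
by rewrite subv_add => /andP[sLH slH]; exists (p, H).
Qed.

End PencilsOfFlags.

Definition induces_line_spread (F : fieldType) (n : nat)
    (S : set (pg_sub F n)) (U : pg_sub F n) : Prop :=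
  line_spread_in U [set l | S l /\ (l <= U)%VS]%classic.

Section LineSpread.
Variables (F : fieldType) (n : nat) (S : set (pg_sub F n)).
Hypothesis spreadS : line_spread S.
Implicit Types p l U W : pg_sub F n.

Lemma spread_line_mem p : pg_point p -> S (spread_line S p).
Proof. by move=> dp; have [] := (spread_lineP _ spreadS dp).2 erefl. Qed.

Lemma sub_spread_line p : pg_point p -> (p <= spread_line S p)%VS.
Proof. by move=> dp; have [] := (spread_lineP _ spreadS dp).2 erefl. Qed.

Lemma pg_line_spread_line p : pg_point p -> pg_line (spread_line S p).
Proof. by move=> dp; have [] := spreadS.1 _ (spread_line_mem dp). Qed.

Lemma spread_line_eq p l :
  pg_point p -> S l -> (p <= l)%VS -> spread_line S p = l.
Proof. by move=> dp Sl spl; apply/esym/(spread_lineP _ spreadS dp). Qed.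

Lemma spread_line_sub_induced U p : induces_line_spread S U ->
  pg_point p -> (p <= U)%VS -> (spread_line S p <= U)%VS.
Proof.
move=> [_ SU] dp spU; have [l [[[Sl slU] spl] _]] := SU p dp spU.
by rewrite (spread_line_eq dp Sl).
Qed.

Lemma spread_line_sub_codim1 U W p : induces_line_spread S U ->
  (U <= W)%VS -> (\dim W <= (\dim U).+1)%N -> pg_point p ->
  (spread_line S p <= W)%VS = (p <= U)%VS.
Proof.
move=> indU sUW leWU dp; apply/idP/idP=> [slW|spU]; last first.
  exact: subv_trans (spread_line_sub_induced indU dp spU) sUW.
have dl : \dim (spread_line S p) = 2%N := pg_line_spread_line dp.
have dim_cap := leq_dimv_cap slW sUW.
have [|q + dq] := @exists_subv_dim _ _ (spread_line S p :&: U)%VS 1.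
  by lia.
rewrite subv_cap => /andP[sql sqU]; apply: subv_trans (sub_spread_line dp) _.
rewrite -(spread_line_eq dq (spread_line_mem dp) sql).
exact: spread_line_sub_induced.
Qed.

End LineSpread.

Section DualLineSpread.
Variables (F : fieldType) (n : nat) (S Sd : set (pg_sub F n)).
Hypotheses (spreadS : line_spread S) (dualSd : dual_line_spread Sd).
Hypothesis inducesS : forall L, Sd L -> induces_line_spread S L.
Implicit Types (p l H L : pg_sub F n) (x : pg_sub F n * pg_sub F n).

Definition dual_spread_member H : pg_sub F n :=
  xget 0%VS [set L | Sd L /\ (L <= H)%VS]%classic.

Lemma dual_spread_memberP H : pg_hyperplane H ->
  Sd (dual_spread_member H) /\ (dual_spread_member H <= H)%VS.
Proof.
move=> dH; have [L [memL _]] := dualSd.2 _ dH.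
by apply: (@xgetPex _ 0%VS [set L | Sd L /\ (L <= H)%VS]%classic); exists L.
Qed.

Lemma pg_subhyperplane_dual_spread_member H :
  pg_hyperplane H -> pg_subhyperplane (dual_spread_member H).
Proof. by move=> dH; apply: dualSd.1; have [] := dual_spread_memberP dH. Qed.

Lemma spread_line_sub_hyperplane p H : pg_point p -> pg_hyperplane H ->
  (spread_line S p <= H)%VS = (p <= dual_spread_member H)%VS.
Proof.
move=> dp dH; have [SdL sLH] := dual_spread_memberP dH.
apply: spread_line_sub_codim1 => //; first exact: inducesS.
move: dH (pg_subhyperplane_dual_spread_member dH).
by rewrite /pg_hyperplane /pg_subhyperplane /pg_codim; lia.
Qed.

Lemma spread_hyperplane_line_ptE l H x :
  pg_hyperplane H -> (l <= H)%VS -> A1n_line_pt l H x ->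
  spread_hyperplane S x <-> (x.1 <= dual_spread_member H)%VS.
Proof.
move=> dH slH lx; have [dx _ ex2] := lx.
rewrite -spread_line_sub_hyperplane // -ex2; split=> [[]//|slx].
by split=> //; apply: A1n_line_pt_sub_points lx.
Qed.

Lemma spread_hyperplane_line_hypE p L x :
  pg_point p -> (p <= L)%VS -> A1n_line_hyp p L x ->
  spread_hyperplane S x <-> (spread_line S p <= x.2)%VS.
Proof.
move=> dp spL Lx; have [ex1 _ _] := Lx.
rewrite -ex1; split=> [[]//|slx].
by split=> //; apply: A1n_line_hyp_sub_points Lx.
Qed.

Lemma spread_hyperplane_subspace :
  geom_subspace (A1n F n) (spread_hyperplane S).
Proof.
split=> [x [] //|A].
case=> [[l [H [dl dH slH ->]]]|[p [L [dp dL spL ->]]]];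
  move=> [x [y [neq [Ax +] [Ay +]]]].
- have memE := spread_hyperplane_line_ptE dH slH.
  move=> /(memE _ Ax) sxM /(memE _ Ay) syM z Az; apply/(memE _ Az).
  have [_ szl _] := Az; apply: subv_trans szl _.
  by rewrite -(A1n_line_pt_join dl Ax Ay neq) subv_add sxM.
- have memE := spread_hyperplane_line_hypE dp spL.
  move=> /(memE _ Ax) slx /(memE _ Ay) sly z Az; apply/(memE _ Az).
  have [_ _ sLz] := Az; apply: subv_trans sLz.
  by rewrite -(A1n_line_hyp_meet dL Ax Ay neq) subv_cap slx.
Qed.

Lemma spread_hyperplane_meets_line A :
  lines (A1n F n) A -> exists x, (A `&` spread_hyperplane S)%classic x.
Proof.
case=> [[l [H [dl dH slH ->]]]|[p [L [dp dL spL ->]]]].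
- have [_ sMH] := dual_spread_memberP dH.
  have dM := pg_subhyperplane_dual_spread_member dH.
  have [x Ax sxM] := A1n_line_pt_meets_subhyperplane dl dH slH dM sMH.
  by exists x; split=> //; apply/(spread_hyperplane_line_ptE dH slH Ax).
- have [x Ax slx] := A1n_line_hyp_meets_line dp dL spL
    (pg_line_spread_line spreadS dp) (sub_spread_line spreadS dp).
  by exists x; split=> //; apply/(spread_hyperplane_line_hypE dp spL Ax).
Qed.

Lemma spread_hyperplane_proper : spread_hyperplane S <> points (A1n F n).
Proof.
have [|H dH _] := @exists_pg_hyperplane F n 0%VS; first by rewrite dimv0.
have dM := pg_subhyperplane_dual_spread_member dH.
have [|p [dp spH nspM]] := @exists_dim1_notin _ _ H (dual_spread_member H).
  apply/negP=> /dimvS; move: dH dM.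
  by rewrite /pg_hyperplane /pg_subhyperplane /pg_codim; lia.
move=> all_points; have : points (A1n F n) (p, H) by [].
rewrite -all_points => -[_ /=].
by rewrite spread_line_sub_hyperplane //; apply/negP.
Qed.

End DualLineSpread.

Theorem theorem1p12 (F : fieldType) (n : nat) (hn : (2 <= n)%N)
    (S : set (pg_sub F n)) (hS : line_spread S) (hd : admits_dual S) :
  geom_hyperplane (A1n F n) (spread_hyperplane S).
Proof.
have [Sd dualSd inducesS] := hd; split.
- exact: spread_hyperplane_subspace hS dualSd inducesS.
- exact: spread_hyperplane_proper hS dualSd inducesS.
- exact: spread_hyperplane_meets_line hS dualSd inducesS.
Qed.
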